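(* Let $A$ be an RJ-algebra over a field $F$ of characteristic $\neq 2$. Then: (a) $A$ has an element $e$ such that $ae=ea=a$ for every $a\in A^2$; (b) the algebra $A$ has no nonzero nilpotent element with a square root, i.e. if $a\in A^2$ and $a^n=0$ for some integer $n\geq 1$, then $a=0$.
   Context: For a Jordan algebra $A$ over a field $F$ of characteristic $\neq 2$ (not assumed unital), write $A^2=\{a^2: a\in A\}$ (the set of squares, i.e. the elements having a square root in $A$), $U_ab=2(ab)a-a^2b$, $U_a(A)=\{U_ax: x\in A\}$, and for $S\subseteq A$ put ${}^\perp S=\{x\in A: U_ax=0 \text{ for all } a\in S\}$. $A$ is called an RJ-algebra if for every $x\in A$ there exists an idempotent $e\in A$ such that ${}^\perp\{x\}\cap A^2=U_e(A)\cap A^2$. An idempotent is an element $e$ with $e^2=e$ (the zero element is allowed). *)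

(* Defs.v *)
From HB Require Import structures.
From mathcomp Require Import all_boot all_order all_algebra.
From mathcomp Require Import boolp classical_sets.

Set Implicit Arguments.
Unset Strict Implicit.
Unset Printing Implicit Defensive.

Import GRing.Theory.
Local Open Scope ring_scope.
Local Open Scope classical_set_scope.

(* Not necessarily unital. The axioms are those of a linear Jordan algebra and
   are the intended notion only in characteristic <> 2, a hypothesis that is
   left to the results. Right bilinearity follows from commutativity. *)
HB.mixin Record Lmodule_isJordan (F : fieldType) A of GRing.Lmodule F A := {
  jmul : A -> A -> A;
  jmulC : commutative jmul;
  jmulDl : left_distributive jmul +%R;
  jmulZl : forall (k : F) (x y : A), jmul (k *: x) y = k *: jmul x y;
  jordan_identity : forall x y : A,
    jmul (jmul (jmul x x) y) x = jmul (jmul x x) (jmul y x)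
}.

#[short(type="jordanAlgType")]
HB.structure Definition Jordan (F : fieldType) :=
  { A of Lmodule_isJordan F A & GRing.Lmodule F A }.

Declare Scope jordan_scope.
Delimit Scope jordan_scope with J.
Notation "x ∘ y" := (jmul x y) (at level 40, left associativity) : jordan_scope.
Local Open Scope jordan_scope.

Section JordanDefs.
Variables (F : fieldType) (A : jordanAlgType F).
Implicit Types (a b e x : A) (S : set A).

(* [jpow a n] is a^n for n >= 1, with a^(n+1) = a^n a; the value at n = 0 is
   meaningless, since A need not have a unit. *)
Definition jpow a n : A := iter n.-1 (fun y => y ∘ a) a.

Definition squares : set A := [set a ∘ a | a in [set: A]].

Definition U a b : A := ((a ∘ b) ∘ a) *+ 2 - (a ∘ a) ∘ b.

Definition perp S : set A := [set x | forall a, S a -> U a x = 0].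

Definition jidempotent e : Prop := e ∘ e = e.

Definition RJ_algebra : Prop :=
  forall x, exists e, jidempotent e /\
    perp [set x] `&` squares = range (U e) `&` squares.

End JordanDefs.

Arguments squares {F} A.
Arguments RJ_algebra {F} A.

(* Main.v *)
Require Import Defs.
From HB Require Import structures.
From mathcomp Require Import all_boot all_order all_algebra.
From mathcomp Require Import classical_sets.

(** Let [e] be the idempotent that the RJ condition attaches to [x].  The range
    of [U e] consists of the elements fixed by [e], so a square [s] satisfies
    [U x s = 0] if and only if [e s = s].  Note that [e = e^2] is a square.

    (a) For [x = 0], every square is fixed by [e].

    (b) By power associativity it suffices that [d^4 = 0] implies [d^2 = 0].
    Take [x = d].  Since [U d d^2 = d^4 = 0] we have [e d^2 = d^2], and
    [U d e = 0] reads [2 d (e d) = d^2].  The Jordan identity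
    [(d^2 e) d = d^2 (e d)] now gives [U d (e d) = 0], so [U d] kills the square
    [(e + d)^2 = e + 2 e d + d^2], which is therefore fixed by [e]; that is,
    [e (e d) = e d].  This forces the multiplications by [e] and by [d] to
    commute, so [d^2 = e (d d) = d (e d)]; comparing with [2 d (e d) = d^2]
    gives [d^2 = 0]. *)

Set Implicit Arguments.
Unset Strict Implicit.
Unset Printing Implicit Defensive.

Import GRing.Theory.
Local Open Scope ring_scope.
Local Open Scope jordan_scope.

Lemma mulr2n_id_eq0 (V : zmodType) (v : V) : v *+ 2 = v -> v = 0.
Proof. by rewrite mulr2n -[RHS]addr0 => /addrI. Qed.

Section JordanTheory.
Variables (F : fieldType) (A : jordanAlgType F).
Implicit Types a d e u v w x y z : A.

Lemma jmul_is_bilinear : bilinear_for *:%R *:%R (@jmul F A).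
Proof.
split=> x k y z /=; first by rewrite jmulDl jmulZl.
by rewrite jmulC jmulDl jmulZl !(jmulC x).
Qed.

HB.instance Definition _ :=
  bilinear_isBilinear.Build F A A A *:%R *:%R (@jmul F A) jmul_is_bilinear.

Lemma U_is_zmod_morphism a : zmod_morphism (U a).
Proof.
move=> x y; rewrite /U !linearBr linearBl mulrnBl !opprD !opprK.
by rewrite addrACA.
Qed.

HB.instance Definition _ a :=
  GRing.isZmodMorphism.Build A A (U a) (U_is_zmod_morphism a).

Definition jcommutator u v w : A := u ∘ (v ∘ w) - v ∘ (u ∘ w).

Lemma jcommutatorC u v w : jcommutator u v w = - jcommutator v u w.
Proof. by rewrite opprB. Qed.

Lemma jcommutatorDl u1 u2 v w :
  jcommutator (u1 + u2) v w = jcommutator u1 v w + jcommutator u2 v w.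
Proof. by rewrite /jcommutator !linearDl linearDr opprD addrACA. Qed.

Lemma jcommutatorNl u v w : jcommutator (- u) v w = - jcommutator u v w.
Proof. by rewrite /jcommutator !linearNl linearNr opprD. Qed.

Lemma jcommutatorDr u v1 v2 w :
  jcommutator u (v1 + v2) w = jcommutator u v1 w + jcommutator u v2 w.
Proof. by rewrite !(jcommutatorC u) jcommutatorDl opprD. Qed.

Lemma jcommutatorNr u v w : jcommutator u (- v) w = - jcommutator u v w.
Proof. by rewrite !(jcommutatorC u) jcommutatorNl. Qed.

Lemma jcommutator_eq0 u v w :
  jcommutator u v w = 0 <-> u ∘ (v ∘ w) = v ∘ (u ∘ w).
Proof. by split=> [/subr0_eq | eq_uv] //; rewrite /jcommutator eq_uv subrr. Qed.

Definition operator_commute u v : Prop :=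
  forall w, u ∘ (v ∘ w) = v ∘ (u ∘ w).

Lemma operator_commute_sqr x : operator_commute x (x ∘ x).
Proof. by move=> y; rewrite (jmulC x y) -jordan_identity jmulC. Qed.

Hypothesis charF : 2%N \notin [pchar F].

Lemma mulr2n_inj : injective (fun v : A => v *+ 2).
Proof.
have two_neq0 : (2%:R : F) != 0 by move: charF; rewrite inE /=.
by move=> v w; rewrite -!(scaler_nat 2); exact: scalerI.
Qed.

(* The part of the Jordan identity at [x + z] that is linear in [z] is isolated
   by comparing [z] with [- z], so that only 2 has to be cancelled. *)
Lemma jordan_linearized x z y :
  jcommutator (x ∘ x) z y = jcommutator x (x ∘ z) y *+ 2.
Proof.
pose lin u v := jcommutator (u ∘ u) v y + jcommutator (u ∘ v) u y *+ 2.
have lin_anti u v : lin u v = - lin v u.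
  have cubic0 w : jcommutator (w ∘ w) w y = 0.
    by apply/jcommutator_eq0; rewrite operator_commute_sqr.
  apply/eqP; rewrite -addr_eq0; apply/eqP; have := cubic0 (u + v).
  rewrite !(linearDl, linearDr) /= !(jcommutatorDl, jcommutatorDr) !cubic0.
  rewrite /lin (jmulC v u) add0r addr0 => <-.
  by rewrite !mulr2n [RHS](AC ((1*2)*(2*1)) ((4*(1*2))*(3*(5*6)))).
have lin_odd : lin x (- z) = - lin x z.
  by rewrite /lin linearNr /= jcommutatorNl jcommutatorNr mulNrn [RHS]opprD.
have lin_even : lin (- z) x = lin z x.
  by rewrite /lin !linearNl linearNr /= opprK jcommutatorNl jcommutatorNr opprK.
suff /eqP : lin x z = 0.
  by rewrite /lin addr_eq0 (jcommutatorC x) mulNrn => /eqP.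
apply: mulr2n_inj; rewrite mul0rn mulr2n.
by rewrite {1}lin_anti -lin_even -lin_anti lin_odd addNr.
Qed.

Lemma operator_commute_mul_sqr a y :
    operator_commute a y -> operator_commute a (a ∘ y) ->
  operator_commute a ((a ∘ a) ∘ y).
Proof.
move=> comm_ay comm_aay z.
have sqr_mul_expand w : ((a ∘ a) ∘ y) ∘ w
    = (a ∘ a) ∘ (y ∘ w) - (a ∘ (y ∘ (a ∘ w)) - (a ∘ y) ∘ (a ∘ w)) *+ 2.
  have := jordan_linearized a w y; rewrite /jcommutator.
  rewrite !(jmulC w) (jmulC (a ∘ w)) (jmulC (a ∘ w) (a ∘ y)) => <-.
  by rewrite subKr.
rewrite !sqr_mul_expand linearBr linearMnr linearBr /=.
by rewrite operator_commute_sqr !comm_ay comm_aay.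
Qed.

Lemma operator_commute_jpow a n : operator_commute a (jpow a n.+1).
Proof.
suff [] : operator_commute a (jpow a n.+1) /\ operator_commute a (jpow a n.+2).
  by [].
elim: n => [|n [comm_n comm_n1]].
  by split=> // w; exact: operator_commute_sqr.
split=> //.
have -> : jpow a n.+3 = (a ∘ a) ∘ jpow a n.+1.
  by rewrite (jmulC (a ∘ a)) -comm_n [RHS]jmulC.
by apply: operator_commute_mul_sqr => //; rewrite jmulC.
Qed.

Lemma jpowD a m n : (0 < m)%N -> (0 < n)%N ->
  jpow a m ∘ jpow a n = jpow a (m + n).
Proof.
case: m n => // m [//|n] _ _; elim: n => [|n IHn]; first by rewrite addn1.
rewrite addnS -[jpow a n.+2]/(jpow a n.+1 ∘ a) (jmulC _ a).
by rewrite -operator_commute_jpow IHn jmulC addSn.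
Qed.

Lemma jpow_eq0_leq a m n : (0 < m <= n)%N -> jpow a m = 0 -> jpow a n = 0.
Proof.
case: m => // m /= /subnKC <- a_m0.
elim: (n - m.+1)%N => [|k IHk]; first by rewrite addn0.
by rewrite addnS -[LHS]/(jpow a (m.+1 + k) ∘ a) IHk linear0l.
Qed.

Section Idempotent.
Variable e : A.
Hypothesis ee : jidempotent e.

Lemma jmul_U_idempotent z : e ∘ U e z = U e z.
Proof.
have := jordan_linearized e z e; rewrite /jcommutator !ee.
rewrite (jmulC z e) (jmulC (e ∘ z) e) => cubic.
apply: subr0_eq; rewrite /U ee linearBr linearMnr /= (jmulC (e ∘ z)).
by rewrite opprD opprK addrACA -mulrnBl -cubic [X in _ + X]addrC subrKA subrr.
Qed.

Lemma range_U_idempotent z : range (U e) z <-> e ∘ z = z.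
Proof.
split=> [[y _ <-] | ez]; first exact: jmul_U_idempotent.
by exists z => //; rewrite /U ee ez jmulC ez mulr2n addrK.
Qed.

Lemma operator_commute_idempotent z :
  e ∘ (e ∘ z) = e ∘ z -> operator_commute e z.
Proof.
move=> eez y; apply/jcommutator_eq0; have := jordan_linearized e (e ∘ z) y.
rewrite ee eez => /esym/mulr2n_id_eq0 comm_ez.
by have := jordan_linearized e z y; rewrite ee comm_ez mul0rn.
Qed.

End Idempotent.

Hypothesis RJ_A : RJ_algebra A.

Lemma RJ_perp_idempotent x : exists2 e, jidempotent e &
  forall s, squares A s -> U x s = 0 <-> e ∘ s = s.
Proof.
have [e [ee perp_x]] := RJ_A x; exists e => // s sq_s.
have /seteqP[sub_perp sub_range] := perp_x.
rewrite -range_U_idempotent //; split=> [Uxs | range_s].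
  by have [] := sub_perp s; first by split=> // _ ->.
by have [/(_ x erefl)] := sub_range s (conj range_s sq_s).
Qed.

Lemma RJ_squares_unit :
  exists e, forall a, squares A a -> a ∘ e = a /\ e ∘ a = a.
Proof.
have [e _ fix_e] := RJ_perp_idempotent 0; exists e => a sq_a.
suff ea : e ∘ a = a by rewrite jmulC.
by apply/fix_e => //; rewrite /U !linear0l mul0rn subr0.
Qed.

Lemma RJ_squares_reduced a : squares A a -> a ∘ a = 0 -> a = 0.
Proof.
case=> d _ <-; set c := d ∘ d => cc.
have [e ee fix_e] := RJ_perp_idempotent d.
have jordan_d y : (c ∘ y) ∘ d = c ∘ (y ∘ d) by exact: jordan_identity.
have ec : e ∘ c = c.
  apply/fix_e; first by exists d.
  by rewrite /U (jmulC d) jordan_d -/c cc mul0rn subr0.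
have Ude : U d e = 0 by apply/fix_e => //; exists e.
pose p := e ∘ d.
have dp2 : (d ∘ p) *+ 2 = c.
  by apply: subr0_eq; rewrite -Ude /U -/c (jmulC c) ec (jmulC _ d) (jmulC d e).
have Udp : U d p = 0.
  by rewrite /U -/c -linearMnl /= dp2 -jordan_d (jmulC c e) ec subrr.
have Udc : U d c = 0 by apply/fix_e => //; exists d.
have fix_s : e ∘ (e + p *+ 2 + c) = e + p *+ 2 + c.
  apply/fix_e; last by rewrite 2!raddfD raddfMn /= Ude Udp Udc mul0rn !addr0.
  exists (e + d) => //.
  by rewrite linearDl !linearDr /= ee (jmulC d e) mulr2n !addrA.
have ep : e ∘ p = p.
  apply: mulr2n_inj; move: fix_s.
  by rewrite 2!linearDr linearMnr /= ee ec => /addIr/addrI.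
have dp : d ∘ p = c by rewrite -operator_commute_idempotent.
by apply: mulr2n_id_eq0; rewrite -[in LHS]dp.
Qed.

Lemma RJ_jpow_eq0 a n : squares A a -> (0 < n)%N -> jpow a n = 0 -> a = 0.
Proof.
move=> sq_a n_gt0 a_n0.
have : jpow a (2 ^ n) = 0.
  by apply: jpow_eq0_leq a_n0; rewrite n_gt0 ltnW // ltn_expl.
elim: n {n_gt0 a_n0} => //= n IHn; rewrite expnS mul2n -addnn.
rewrite -jpowD ?expn_gt0 // => /RJ_squares_reduced a_n0; apply/IHn/a_n0.
case: (n) => // k; exists (jpow a (2 ^ k)) => //.
by rewrite jpowD ?expn_gt0 // addnn -mul2n -expnS.
Qed.

End JordanTheory.

Theorem lemma1p3 (F : fieldType) (charF : 2%N \notin [pchar F])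
    (A : jordanAlgType F) (RJ_A : RJ_algebra A) :
  (exists e : A, forall a : A, squares A a -> a ∘ e = a /\ e ∘ a = a) /\
  (forall (a : A) (n : nat),
      squares A a -> (1 <= n)%N -> jpow a n = 0 -> a = 0).
Proof.
split; first exact: RJ_squares_unit.
by move=> a n; exact: RJ_jpow_eq0.
Qed.
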